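(* Let $f:\mathbb{R}^n\to\mathbb{R}^n$ be a locally Lipschitz vector field and consider the system $\dot{x}=f(x)$, $x\in\mathbb{R}^n$. Let $x_0\in\mathbb{R}^n$ be a point for which the positive orbit $\gamma^+(x_0)=\{\phi(t,x_0):t\geq 0\}$ is bounded. Let $V\in C^1(\mathbb{R}^n)$ be a given real-valued function and define $S=\{x\in\mathbb{R}^n:\nabla V(x)f(x)=0\}$. Then $\omega(x_0)\cap S\neq\emptyset$. Furthermore, define $A=\{x\in\mathbb{R}^n:\exists t\geq 0\text{ with }\phi(t,x)\in S\}$ and let $M\subseteq\bar{A}$ be the largest invariant set for the system in the closure $\bar{A}$ of $A$. Then the inclusion $\omega(x_0)\subseteq M$ holds.
   Context: For $x\in\mathbb{R}^n$, $\phi(t,x)$ denotes the unique solution at time $t\geq 0$ of $\dot{x}=f(x)$ with initial condition $x$ at time $0$, defined on its maximal forward interval $[0,t_{\max}(x))$, $t_{\max}(x)\in(0,+\infty]$ (if $t_{\max}(x)<+\infty$, then the solution is unbounded on $[0,t_{\max}(x))$; thus a bounded positive orbit has $t_{\max}=+\infty$). In the definition of $A$, the time $t$ ranges over $[0,t_{\max}(x))$. A non-empty set $B\subseteq\mathbb{R}^n$ is positively invariant if for every $y\in B$ it holds that $\phi(t,y)\in B$ for all $t\in[0,t_{\max}(y))$. A non-empty set $B\subseteq\mathbb{R}^n$ is negatively invariant if the following implication holds: if $\phi(t,y)\in B$ for certain $y\in\mathbb{R}^n$ and $t\in[0,t_{\max}(y))$, then $y\in B$. A set is invariant if it is both positively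 and negatively invariant. The largest invariant set in a set $B$ is the union of all invariant sets contained in $B$. The $\omega$-limit set of $x_0$ is $\omega(x_0)=\{y\in\mathbb{R}^n:\exists\{t_k\geq 0:k=1,2,\ldots\}\text{ with }\lim_{k\to+\infty}t_k=+\infty\text{ and }\lim_{k\to+\infty}\phi(t_k,x_0)=y\}$. $\nabla V(x)$ is the gradient (as a row vector), so $\nabla V(x)f(x)$ is the scalar product of the gradient with $f(x)$. *)

(* Defs.v *)
From HB Require Import structures.
From mathcomp Require Import all_boot all_order all_algebra.
From mathcomp Require Import all_classical all_reals all_analysis.

Set Implicit Arguments.
Unset Strict Implicit.
Unset Printing Implicit Defensive.

Import Order.TTheory GRing.Theory Num.Theory.
Import numFieldNormedType.Exports.

Local Open Scope classical_set_scope.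
Local Open Scope ring_scope.

(* Points of R^n are row vectors 'rV[R]_n; the norm is the library's sup norm, *)
(* which yields the same bounded sets, topology and Lipschitz maps as the      *)
(* Euclidean one.                                                              *)

Section Dynamics.
Context {R : realType} {n : nat}.
Local Notation E := 'rV[R]_n.
Implicit Types (f : E -> E) (V : E -> R) (B : set E).

Definition locally_lipschitz f : Prop :=
  forall x : E, exists2 U : set E, nbhs x U & [lipschitz f y | y in U].

Definition gradient V (x : E) : E := \row_i 'D_(delta_mx 0 i) V x.

Definition C1 V : Prop :=
  (forall x, differentiable V x) /\ continuous (gradient V).

(* the interval [0, T) for T an extended real *)
Definition forward_interval (T : \bar R) : set R :=
  [set t | 0 <= t /\ (t%:E < T)%E].

(* The limit of the difference quotient is taken within [0, T): it is the      *)
(* two-sided derivative for 0 < t < T and the right derivative at t = 0.       *)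
(* Values of u outside [0, T) are irrelevant.                                  *)
Definition ivp_solution f (x : E) (T : \bar R) (u : R -> E) : Prop :=
  u 0 = x /\
  forall t, forward_interval T t ->
    (s - t)^-1 *: (u s - u t) @[s --> within (forward_interval T) t^']
      --> f (u t).

(* maximality is non-extendability to a longer forward interval *)
Definition maximal_solution f (x : E) (T : \bar R) (u : R -> E) : Prop :=
  [/\ (0 < T)%E,
      ivp_solution f x T u &
      forall (T' : \bar R) (v : R -> E), (T <= T')%E ->
        ivp_solution f x T' v ->
        (forall t, forward_interval T t -> v t = u t) -> T' = T].

(* phi t x is the value at time t of the maximal solution issued from x, whose *)
(* forward interval of existence is [0, tmax x).                               *)
Definition is_flow f (tmax : E -> \bar R) (phi : R -> E -> E) : Prop :=
  forall x, maximal_solution f x (tmax x) (phi ^~ x).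

Section Flow.
Variables (tmax : E -> \bar R) (phi : R -> E -> E).

Definition positive_orbit (x : E) : set E :=
  [set phi t x | t in forward_interval (tmax x)].

Definition omega_limit (x : E) : set E :=
  [set y | exists t_ : nat -> R,
    [/\ forall k, forward_interval (tmax x) (t_ k),
        t_ k @[k --> \oo] --> +oo &
        phi (t_ k) x @[k --> \oo] --> y]].

Definition positively_invariant B : Prop :=
  B !=set0 /\
  forall y, B y -> forall t, forward_interval (tmax y) t -> B (phi t y).

Definition negatively_invariant B : Prop :=
  B !=set0 /\
  forall y t, forward_interval (tmax y) t -> B (phi t y) -> B y.

Definition invariant_set B : Prop :=
  positively_invariant B /\ negatively_invariant B.

Definition largest_invariant_set B : set E :=
  \bigcup_(C in [set C | invariant_set C /\ C `<=` B]) C.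

Definition reaches B : set E :=
  [set x | exists2 t, forward_interval (tmax x) t & B (phi t x)].

End Flow.

Definition orbital_critical_set f V : set E :=
  [set x | \sum_i gradient V x 0 i * f x 0 i = 0].

End Dynamics.

(* Main.v *)
(* If the orbit of x0 meets S at arbitrarily large times, a subsequence of these
   meetings converges to a point of omega(x0), which lies in S since S is closed;
   moreover every point of the orbit then lies in A, so omega(x0) lies in the
   closure of A.  Otherwise the derivative of V along the orbit eventually keeps
   a constant sign, V is eventually monotone along it, and hence V is constant on
   omega(x0); through each point of omega(x0) runs a complete solution contained
   in omega(x0), so differentiating V along it gives omega(x0) <= S <= A.

   Complete solutions in omega(x0) arise as limits of the time-translates
   s |-> phi(t_k + s, x0), which converge pointwise by Gronwall's inequality on a
   compact ball containing the orbit.  Together with uniqueness, forwards and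
   backwards, they give the invariance of omega(x0).  No existence theorem for
   ODEs is needed: a bounded solution whose interval of existence is finite is
   extended by the maximal solution issued from its end point. *)

Require Import Defs.
From HB Require Import structures.
From mathcomp Require Import all_boot all_order all_algebra.
From mathcomp Require Import all_classical all_reals all_analysis.
From mathcomp Require Import ring lra.

Import Order.TTheory GRing.Theory Num.Theory.
Import numFieldNormedType.Exports.

Local Open Scope classical_set_scope.
Local Open Scope ring_scope.

(** * Differentiable curves, the mean value inequality and a Gronwall estimate *)

Section Curves.
Context {R : realType} {E : normedModType R}.
Implicit Types (I : set R) (u : R -> E).

(* Relative to [I]: one-sided at the endpoints of an interval. *)
Definition has_derivative_at I u (t : R) (v : E) : Prop :=
  forall e : R, 0 < e -> exists2 d : R, 0 < d &
    forall s, I s -> `|s - t| < d ->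
      `|u s - u t - (s - t) *: v| <= e * `|s - t|.

Definition integral_curve (f : E -> E) I u : Prop :=
  forall t, I t -> has_derivative_at I u t (f (u t)).

(* A quantitative form of [u' = f u] that is stable under pointwise limits of *)
(* curves and passes to the endpoint of an interval of existence. *)
Definition quadratic_curve (f : E -> E) (C : R) I u : Prop :=
  forall s t, I s -> I t ->
    `|u t - u s - (t - s) *: f (u s)| <= C * (t - s) ^+ 2.

(** Bridges the punctured limit in [ivp_solution] and a division-free estimate where [s = t] is
    harmless. *)
Lemma difference_quotientP I u t v :
  ((s - t)^-1 *: (u s - u t) @[s --> within I t^'] --> v) <->
  has_derivative_at I u t v.
Proof.
split=> [/cvgrPdist_le cv e e0|h].
  have := cv _ e0; rewrite near_withinE /dnbhs near_withinE => /nbhs_ballP[d /= d0 hd].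
  exists d => // s Is sd; have [->|st] := eqVneq s t.
    by rewrite !subrr scale0r subr0 !normr0 mulr0.
  have : ball t d s by rewrite /ball /= distrC.
  move=> /hd/(_ st Is).
  have st0 : s - t != 0 by rewrite subr_eq0.
  move=> h; rewrite mulrC -ler_pdivrMl ?normr_gt0// -normfV -normrZ.
  by rewrite scalerBr (scalerA _ (s - t)) mulVf// scale1r distrC.
apply/cvgrPdist_le => e e0; rewrite near_withinE /dnbhs near_withinE.
have [d d0 hd] := h _ e0; apply/nbhs_ballP; exists d => //= s.
rewrite /ball /= distrC => sd st Is.
have st0 : s - t != 0 by rewrite subr_eq0.
have := hd s Is sd; rewrite mulrC -ler_pdivrMl ?normr_gt0// -normfV -normrZ distrC.
by rewrite scalerBr (scalerA _ (s - t)) mulVf// scale1r distrC.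
Qed.

Lemma has_derivative_at_sub I J u t v :
  I `<=` J -> has_derivative_at J u t v -> has_derivative_at I u t v.
Proof.
by move=> IJ h e /h[d d0 hd]; exists d => // s /IJ; exact: hd.
Qed.

Lemma integral_curve_sub f I J u :
  I `<=` J -> integral_curve f J u -> integral_curve f I u.
Proof. by move=> IJ h t It; apply/(has_derivative_at_sub _ _ _ _ _ IJ)/h/IJ. Qed.

Lemma quadratic_curve_integral f C I u :
  quadratic_curve f C I u -> integral_curve f I u.
Proof.
move=> h t It e e0; have C0 : 0 < `|C| + 1 by rewrite ltr_wpDl.
exists (e / (`|C| + 1)); first exact: divr_gt0.
move=> s Is; rewrite ltr_pdivlMr// => sd; apply: le_trans (h t s It Is) _.
rewrite -real_normK ?num_real// expr2 mulrA ler_wpM2r// mulrC.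
by apply: le_trans (ltW sd); rewrite ler_wpM2l// (le_trans (ler_norm C))// lerDl.
Qed.

(** Vector-valued curves may have no mean value point. Instead, for each slack [e], the set where
    the bound with slope [B + e] holds contains its supremum [s], and differentiability at [s]
    pushes past [s] unless [s = b]. *)
Lemma mean_value_inequality (u c : R -> E) (a b B : R) : a <= b ->
  (forall t, t \in `[a, b] -> has_derivative_at `[a, b] u t (c t)) ->
  (forall t, t \in `[a, b] -> `|c t| <= B) ->
  `|u b - u a| <= B * (b - a).
Proof.
move=> ab hu hc; apply/ler_addgt0Pr => e0 e0_gt0.
have [->|ab'] := eqVneq a b; first by rewrite !subrr normr0 mulr0 add0r ltW.
have ba : 0 < b - a by rewrite subr_gt0 lt_neqAle ab'.
have : 0 < e0 / (b - a) by exact: divr_gt0.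
move: (e0 / _) (divfK (lt0r_neq0 ba) e0) => e <- {e0 e0_gt0} e_gt0.
rewrite -mulrDl.
have step x y : x \in `[a, b] -> y \in `[a, b] ->
    `|u y - u x - (y - x) *: c x| <= e * `|y - x| ->
    `|u y - u x| <= (B + e) * `|y - x|.
  move=> xab yab h; rewrite -(subrK ((y - x) *: c x) (u y - u x)).
  apply: le_trans (ler_normD _ _) _; rewrite addrC mulrDl lerD//.
  by rewrite normrZ mulrC ler_wpM2r// hc.
pose A := [set x | x \in `[a, b] /\ `|u x - u a| <= (B + e) * (x - a)].
have Aa : A a by rewrite /A /= in_itv/= lexx ab !subrr normr0 mulr0.
have supA : has_sup A.
  by split; [exists a|exists b => x [+ _]; rewrite in_itv/= => /andP[]].
have Ale x : A x -> x <= sup A by move=> Ax; exact: (sup_upper_bound supA Ax).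
set s := sup A in Ale *.
have as_ : a <= s by exact: Ale.
have sb : s <= b by apply: ge_sup => [|x [+ _]]; [exact: supA.1|rewrite in_itv/= => /andP[]].
have sab : s \in `[a, b] by rewrite in_itv/= as_.
have [d d0 hd] := hu s sab _ e_gt0.
have As : A s.
  split=> //; have [x Ax sx] := sup_adherent d0 supA; have [xab xA] := Ax.
  have xs : x <= s by exact: Ale.
  have dx : `|x - s| < d by rewrite distrC ger0_norm ?subr_ge0// ltrBlDr -ltrBlDl.
  have := step _ _ sab xab (hd _ xab dx).
  rewrite distrC (distrC x) (ger0_norm (_ : 0 <= s - x)) ?subr_ge0// => h.
  rewrite -(subrK (u x) (u s)) -addrA (le_trans (ler_normD _ _))//.
  have -> : (B + e) * (s - a) = (B + e) * (s - x) + (B + e) * (x - a) by ring.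
  exact: lerD.
have [sb'|bs] := ltP s b; last first.
  by have <- : s = b by [apply/le_anti; rewrite sb bs]; case: As.
(* A point past [s] but within [d] of it; its membership in [A] contradicts [s = sup A]. *)
pose x := Num.min b (s + d / 2).
have sx : s < x by rewrite lt_min sb' ltrDl divr_gt0.
have xab : x \in `[a, b] by rewrite in_itv/= (le_trans as_ (ltW sx)) ge_min lexx.
have xd : `|x - s| < d.
  rewrite ger0_norm ?subr_ge0 ?(ltW sx)// ltrBlDr gt_min.
  by apply/orP; right; rewrite addrC ltrD2r; lra.
suff : A x by move=> /Ale; rewrite leNgt sx.
split=> //; rewrite -(subrK (u s) (u x)) -addrA (le_trans (ler_normD _ _))//.
have -> : (B + e) * (x - a) = (B + e) * (x - s) + (B + e) * (s - a) by ring.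
apply: lerD As.2; apply: le_trans (step _ _ sab xab (hd _ xab xd)) _.
by rewrite ger0_norm ?subr_ge0 ?(ltW sx).
Qed.

(** Bounding [c] only at times no farther from [s] than [t] allows a bound that depends on the
    elapsed time. *)
Lemma mean_value_inequality_interval I (u c : R -> E) (s t B : R) :
  is_interval I -> I s -> I t ->
  (forall r, I r -> has_derivative_at I u r (c r)) ->
  (forall r, I r -> `|r - s| <= `|t - s| -> `|c r| <= B) ->
  `|u t - u s| <= B * `|t - s|.
Proof.
move=> itvI Is It hu hc; have [st|/ltW ts] := leP s t.
  have subI : `[s, t] `<=` I.
    by move=> r; rewrite /= in_itv/= => str; exact: itvI Is It _ str.
  rewrite ger0_norm ?subr_ge0//; apply: (mean_value_inequality _ c) => // r rst.
    by apply/(has_derivative_at_sub _ _ _ _ _ subI)/hu/subI.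
  apply: hc; first exact: subI.
  move: rst; rewrite in_itv/= => /andP[sr rt].
  by rewrite !ger0_norm ?subr_ge0// lerD2r.
have subI : `[t, s] `<=` I.
  by move=> r; rewrite /= in_itv/= => str; exact: itvI It Is _ str.
rewrite distrC (distrC t) ger0_norm ?subr_ge0//.
apply: (mean_value_inequality _ c) => // r rst.
  by apply/(has_derivative_at_sub _ _ _ _ _ subI)/hu/subI.
apply: hc; first exact: subI.
move: rst; rewrite in_itv/= => /andP[sr rt].
by rewrite distrC (distrC t) !ger0_norm ?subr_ge0// lerD2l lerN2.
Qed.

Lemma integral_curve_lipschitz f I u B : is_interval I ->
  integral_curve f I u -> (forall t, I t -> `|f (u t)| <= B) ->
  forall s t, I s -> I t -> `|u t - u s| <= B * `|t - s|.
Proof.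
move=> itvI fu fB s t Is It.
by apply: (mean_value_inequality_interval I u (f \o u)) => //= r Ir _; exact: fB.
Qed.

(** Subtracting [r *: f (u s)] leaves a curve with velocity [f (u r) - f (u s)], of norm at most
    [L * B] times the elapsed time because [u] is [B]-Lipschitz. *)
Lemma integral_curve_quadratic f I u (K : set E) L B : is_interval I ->
  integral_curve f I u -> (forall t, I t -> K (u t)) ->
  0 <= L -> (forall x y, K x -> K y -> `|f x - f y| <= L * `|x - y|) ->
  (forall x, K x -> `|f x| <= B) ->
  quadratic_curve f (L * B) I u.
Proof.
move=> itvI fu uK L0 fL fB s t Is It.
pose g r := u r - r *: f (u s).
have -> : u t - u s - (t - s) *: f (u s) = g t - g s.
  by rewrite /g scalerBl [in RHS]opprD [RHS]addrACA -opprD.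
rewrite -real_normK ?num_real// expr2 mulrA.
apply: (mean_value_inequality_interval I g (fun r => f (u r) - f (u s))) => //.
  move=> r Ir e /(fu _ Ir)[d d0 hd]; exists d => // x Ix /(hd _ Ix) h.
  suff -> : g x - g r - (x - r) *: (f (u r) - f (u s)) =
    u x - u r - (x - r) *: f (u r) by [].
  rewrite /g scalerBr (scalerBl x r (f (u s))).
  by rewrite (opprD (u r)) (addrACA (u x)) -opprD (opprB _ (_ - _)) addrA subrK.
move=> r Ir rs; apply: le_trans (fL _ _ (uK _ Ir) (uK _ Is)) _.
rewrite -mulrA ler_wpM2l//.
have B0 : 0 <= B by apply: le_trans (fB _ (uK _ Is)).
apply: le_trans (ler_wpM2l B0 rs).
by apply: (integral_curve_lipschitz f I) => // x Ix; exact/fB/uK.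
Qed.

(** One Euler step: both curves leave their tangents at [s] by a quadratic error, and the tangents
    are compared through the Lipschitz bound. *)
Lemma quadratic_curve_step f I u v (K : set E) L C s t :
  quadratic_curve f C I u -> quadratic_curve f C I v ->
  (forall t, I t -> K (u t)) -> (forall t, I t -> K (v t)) ->
  (forall x y, K x -> K y -> `|f x - f y| <= L * `|x - y|) ->
  I s -> I t ->
  `|u t - v t| <= (1 + L * `|t - s|) * `|u s - v s| + 2 * C * (t - s) ^+ 2.
Proof.
move=> qu qv uK vK fL Is It.
have -> : u t - v t = (u s - v s + (t - s) *: (f (u s) - f (v s))) +
   ((u t - u s - (t - s) *: f (u s)) - (v t - v s - (t - s) *: f (v s))).
  rewrite scalerBr (opprD (v t - v s)) (addrACA (u t - u s)) -opprD.
  by rewrite (opprD (v t)) (addrACA (u t)) -opprD -addrA -opprD subrKC.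
have := qu s t Is It; have := qv s t Is It.
have := fL _ _ (uK _ Is) (vK _ Is).
move=> h1 h2 h3; apply: le_trans (ler_normD _ _) _; apply: lerD.
  apply: le_trans (ler_normD _ _) _; rewrite mulrDl mul1r lerD2l normrZ.
  by rewrite mulrC (mulrAC L) ler_wpM2r.
apply: le_trans (ler_normB _ _) _; rewrite -mulrA mulr_natl mulr2n.
exact: lerD.
Qed.

(** The one-step estimate is iterated over ever finer uniform subdivisions. Either order of [s] and
    [t] is allowed, so it also works backwards in time. *)
Lemma quadratic_curve_gronwall f I u v (K : set E) L C :
  is_interval I ->
  quadratic_curve f C I u -> quadratic_curve f C I v ->
  (forall t, I t -> K (u t)) -> (forall t, I t -> K (v t)) ->
  0 <= L -> (forall x y, K x -> K y -> `|f x - f y| <= L * `|x - y|) ->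
  forall s t, I s -> I t ->
  `|u t - v t| <= expR (L * `|t - s|) * `|u s - v s|.
Proof.
move=> itvI qu qv uK vK L0 fL s t Is It.
have [->|st] := eqVneq s t; first by rewrite subrr normr0 mulr0 expR0 mul1r.
have D0 : 0 < `|t - s| by rewrite normr_gt0 subr_eq0 eq_sym.
have C0 : 0 <= C.
  have : 0 <= C * (t - s) ^+ 2 by apply: le_trans (qu s t Is It).
  by rewrite pmulr_lge0// -real_normK ?num_real// exprn_gt0.
(* Euler steps: [N] steps of length [|t - s| / N] give an error O(1 / N). *)
have euler (N : nat) : (0 < N)%N -> `|u t - v t| <=
    expR (L * `|t - s|) * (`|u s - v s| + 2 * C * `|t - s| ^+ 2 / N%:R).
  move=> N0; have N0' : 0 < N%:R :> R by rewrite ltr0n.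
  pose r k := s + (t - s) * (k%:R / N%:R).
  have rI k : (k <= N)%N -> I (r k).
    move=> kN; have k1 : k%:R / N%:R <= 1 :> R.
      by rewrite ler_pdivrMr// mul1r ler_nat.
    have k0 : 0 <= k%:R / N%:R :> R by rewrite divr_ge0.
    have [st'|ts'] := leP s t.
      by apply: (itvI s t) => //; rewrite /r; apply/andP; split; nra.
    by apply: (itvI t s) => //; rewrite /r; apply/andP; split; nra.
  have rE k : r k.+1 - r k = (t - s) / N%:R.
    by rewrite /r -natr1; field; rewrite lt0r_neq0.
  pose h := `|t - s| / N%:R.
  have h0 : 0 < h by exact: divr_gt0.
  have ind k : (k <= N)%N -> `|u (r k) - v (r k)| <=
      expR (L * h) ^+ k * (`|u s - v s| + 2 * C * h ^+ 2 * k%:R).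
    elim: k => [_|k ih kN].
      by rewrite expr0 mul1r /r mul0r mulr0 addr0 mulr0 addr0.
    have := quadratic_curve_step _ _ _ _ _ _ _ _ _ qu qv uK vK fL
      (rI _ (ltnW kN)) (rI _ kN).
    rewrite rE -(real_normK (num_real (_ / _))) normrM normfV (ger0_norm (ltW N0')).
    rewrite -/h => /le_trans; apply.
    (* [expR (L * h)] absorbs the growth factor, and its powers, being at least 1, absorb the new
       quadratic error. *)
    have E1 : 1 + L * h <= expR (L * h) by exact: expR_ge1Dx.
    have Lh0 : 0 <= L * h by rewrite mulr_ge0// ltW.
    have E1k : 1 <= expR (L * h) ^+ k.+1.
      by rewrite exprn_ege1// (le_trans _ E1)// lerDl.
    have Ch : 0 <= 2 * C * h ^+ 2 by rewrite !mulr_ge0// sqr_ge0.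
    rewrite -(@natr1 _ k) (mulrDr (2 * C * h ^+ 2)) mulr1 addrA mulrDr; apply: lerD; last first.
      by rewrite -[leLHS]mul1r ler_wpM2r.
    rewrite exprS -mulrA; apply: ler_pM (ih (ltnW kN)) => //.
    by rewrite addr_ge0.
  have := ind N (leqnn _).
  rewrite /r divff ?lt0r_neq0// mulr1 subrKC.
  rewrite -expRM_natl /h.
  have -> : N%:R * (L * (`|t - s| / N%:R)) = L * `|t - s|.
    by field; rewrite lt0r_neq0.
  have -> // : 2 * C * (`|t - s| / N%:R) ^+ 2 * N%:R = 2 * C * `|t - s| ^+ 2 / N%:R.
  by field; rewrite lt0r_neq0.
apply/ler_addgt0Pr => e e0.
(* Any [N] above [Q / e] makes the accumulated error at most [e]. *)
pose Q := expR (L * `|t - s|) * (2 * C * `|t - s| ^+ 2).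
have Q0 : 0 <= Q by rewrite !mulr_ge0// ?expR_ge0 ?exprn_ge0.
have := archi_boundP (divr_ge0 Q0 (ltW e0)); set N := Num.bound _ => QN.
have N0 : (0 < N)%N.
  by rewrite -(ltr0n R); apply: le_lt_trans QN; exact: divr_ge0 Q0 (ltW e0).
apply: le_trans (euler N N0) _; rewrite mulrDr lerD2l mulrA ler_pdivrMr ?ltr0n//.
by rewrite -/Q mulrC -ler_pdivrMr// ltW.
Qed.

End Curves.

(** * Lipschitz constants on compact sets and uniqueness of integral curves *)

Section RowVectors.
Context {R : realType} {n : nat}.
Local Notation E := 'rV[R]_n.
Implicit Types (f : E -> E) (u v : R -> E) (K : set E) (I : set R).

Lemma locally_lipschitz_nbhs f (x : E) : locally_lipschitz f ->
  exists (U : set E) (M : R), [/\ nbhs x U, 0 < M &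
    forall y z, U y -> U z -> `|f y - f z| <= M * `|y - z|].
Proof.
move=> /(_ x)[U xU]; rewrite /lipschitz_on => fU; have [M [fM M0]] :=
  filter_ex (filterI fU (nbhs_pinfty_gt (num_real 0))).
by exists U, M; split=> // y z Uy Uz; exact: (fM (y, z)).
Qed.

Lemma locally_lipschitz_continuous f : locally_lipschitz f -> continuous f.
Proof.
move=> fl x; have [U [M [xU M0 fU]]] := locally_lipschitz_nbhs _ x fl.
have [d /= d0 dU] := (nbhs_ballP x U).1 xU.
apply/(@cvgrPdist_le _ _ _ (nbhs (x : E))) => e e0; apply/nbhs_ballP.
exists (Num.min d (e / M)); first by rewrite /= lt_min d0 divr_gt0.
move=> y; rewrite -ball_normE /= lt_min => /andP[xyd xye].
apply: le_trans (fU _ _ (nbhs_singleton xU) _) _.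
  by apply: dU; rewrite -ball_normE.
by rewrite mulrC -ler_pdivlMr// ltW.
Qed.

(** By compactness of the square of [K]: near a diagonal point the local constant serves; near any
    other pair the points stay more than [c] apart and the values less than [B] apart, so [B / c]
    serves. *)
Lemma locally_lipschitz_compact f K : locally_lipschitz f -> compact K ->
  exists2 L, 0 <= L & forall x y, K x -> K y -> `|f x - f y| <= L * `|x - y|.
Proof.
move=> fl cK; have fc := locally_lipschitz_continuous _ fl.
pose P (M : R) (z : E * E) := `|f z.1 - f z.2| <= M * `|z.1 - z.2|.
have cKK := (compact_near_coveringP (K `*` K)).1 (compact_setX cK cK).
have : \forall M \near +oo, K `*` K `<=` P M.
  apply: cKK => -[x x'] [/= Kx Kx']; have [xx'|xx'] := eqVneq x x'.
    subst x'; have [U [M [xU M0 fU]]] := locally_lipschitz_nbhs _ x fl.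
    exists (U `*` U, [set N | M <= N]).
      by split; [exists (U, U)|exact: nbhs_pinfty_ge (num_real _)].
    move=> [[y z] N] [[/= Uy Uz]] MN; apply: le_trans (fU _ _ Uy Uz) _.
    exact: ler_wpM2r.
  have xx0 : 0 < `|x - x'| by rewrite normr_gt0 subr_eq0.
  pose c := `|x - x'| / 2; have c0 : 0 < c by exact: divr_gt0.
  pose B := `|f x - f x'| + 1; have B0 : 0 < B by rewrite ltr_wpDl.
  have c1 : (fun z : E * E => `|z.1 - z.2|) z @[z --> (x, x')] --> `|x - x'|.
    by apply: cvg_norm; apply: cvgB; [exact: cvg_fst|exact: cvg_snd].
  have c2 : (fun z : E * E => `|f z.1 - f z.2|) z @[z --> (x, x')] -->
      `|f x - f x'|.
    apply: cvg_norm; apply: cvgB.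
      by apply: (cvg_comp fst f) (fc x); exact: cvg_fst.
    by apply: (cvg_comp snd f) (fc x'); exact: cvg_snd.
  exists ([set z | c < `|z.1 - z.2|] `&` [set z | `|f z.1 - f z.2| < B],
          [set N | B / c <= N]).
    split; last exact: nbhs_pinfty_ge (num_real _).
    apply: filterI; first by apply: cvgr_gt c1 _ _; rewrite /c; lra.
    by apply: cvgr_lt c2 _ _; rewrite ltrDl.
  move=> [[y z] N] [[/= cyz fB]] BN; apply: le_trans (ltW fB) _.
  rewrite ler_pdivrMr// in BN; apply: le_trans (BN) _.
  rewrite ler_wpM2l ?(ltW cyz)//.
  by rewrite -(pmulr_lge0 _ c0); apply: le_trans BN; exact: ltW.
move=> h; have [M [KM M0]] :=
  filter_ex (filterI h (nbhs_pinfty_gt (num_real 0))).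
by exists M; [exact: ltW|move=> x y Kx Ky; exact: (KM (x, y))].
Qed.

Lemma compact_closed_ball0 (r : R) : compact [set x : E | `|x| <= r].
Proof.
apply: bounded_closed_compact.
  by exists r; split=> [|M rM x /= xr]; [exact: num_real|exact: le_trans xr (ltW rM)].
apply: (@closed_comp _ _ (fun x : E => `|x|) [set y | y <= r]).
  by move=> x _; exact: norm_continuous.
exact: closed_le.
Qed.

Lemma locally_lipschitz_ball f r : locally_lipschitz f ->
  exists L B : R, [/\ 0 <= L,
    forall x y, `|x| <= r -> `|y| <= r -> `|f x - f y| <= L * `|x - y| &
    forall x, `|x| <= r -> `|f x| <= B].
Proof.
move=> fl; have [L L0 fL] := locally_lipschitz_compact _ _ fl (compact_closed_ball0 r).
exists L, (L * r + `|f 0|); split=> // x xr.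
have r0 : 0 <= r by apply: le_trans xr.
rewrite -[f x](subrK (f 0)) (le_trans (ler_normD _ _))// lerD2r.
apply: le_trans (fL x 0 xr _) _; first by rewrite /= normr0.
by rewrite subr0 ler_wpM2l.
Qed.

(** Differentiability with tolerance 1 bounds [u] near each time; compactness of the segment makes
    the bound uniform. *)
Lemma integral_curve_bounded f u (a b : R) : integral_curve f `[a, b] u ->
  exists r, forall t, t \in `[a, b] -> `|u t| <= r.
Proof.
move=> fu; have := (compact_near_coveringP `[a, b]).1 (@segment_compact R a b).
pose P (M t : R) := t \in `[a, b] -> `|u t| <= M.
move=> /(_ R +oo P _)[|M [Mr h]].
  move=> t tab; have [d d0 hd] := fu t tab 1 ltr01.
  pose B := `|u t| + `|f (u t)| * d + d.
  exists ([set s | `|s - t| < d], [set M | B <= M]).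
    split; last exact: nbhs_pinfty_ge (num_real _).
    apply/nbhs_ballP; exists d => //= s; by rewrite /ball/= distrC.
  move=> [s M] [/= st BM] sab; apply: le_trans BM.
  have := hd s sab st; rewrite mul1r => h.
  have -> : u s = u t + (s - t) *: f (u t) + (u s - u t - (s - t) *: f (u t)).
    by rewrite -addrA !subrKC.
  apply: le_trans (ler_normD _ _) _; apply: lerD; last first.
    by apply: le_trans h _; exact: ltW.
  apply: le_trans (ler_normD _ _) _; rewrite lerD2l normrZ mulrC.
  by rewrite ler_wpM2l// ltW.
have MM : M < M + 1 by rewrite ltrDl.
by exists (M + 1) => t tab; exact: (h _ MM t tab tab).
Qed.

(** Both curves stay in one ball, where Gronwall applies with zero difference at [s]. As [s] is any
    time of the segment, backward uniqueness is included. *)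
Lemma integral_curve_unique f u v (a b s : R) : locally_lipschitz f ->
  integral_curve f `[a, b] u -> integral_curve f `[a, b] v ->
  s \in `[a, b] -> u s = v s -> {in `[a, b], u =1 v}.
Proof.
move=> fl fu fv sab uv t tab.
have [r ur] := integral_curve_bounded _ _ _ _ fu.
have [q vq] := integral_curve_bounded _ _ _ _ fv.
have [L [B [L0 fL fB]]] := locally_lipschitz_ball _ (Num.max r q) fl.
pose K := [set x : E | `|x| <= Num.max r q].
have uK x : x \in `[a, b] -> K (u x) by move=> /ur h; rewrite /K /= le_max h.
have vK x : x \in `[a, b] -> K (v x).
  by move=> /vq h; rewrite /K /= le_max h orbT.
have itv : is_interval `[a, b] by exact: interval_is_interval.
have qu := integral_curve_quadratic _ _ _ K _ _ itv fu uK L0 fL fB.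
have qv := integral_curve_quadratic _ _ _ K _ _ itv fv vK L0 fL fB.
have := quadratic_curve_gronwall _ _ _ _ _ _ _ itv qu qv uK vK L0 fL s t sab tab.
by rewrite uv subrr normr0 mulr0 normr_le0 subr_eq0 => /eqP.
Qed.

End RowVectors.

(** * Maximal solutions; bounded ones exist for all forward time *)

Section MaximalSolutions.
Context {R : realType} {n : nat}.
Local Notation E := 'rV[R]_n.
Implicit Types (f : E -> E) (u v : R -> E) (T : \bar R).

Lemma forward_interval_is_interval T : is_interval (forward_interval T).
Proof.
move=> x y [x0 xT] [y0 yT] z /andP[xz zy]; split; first exact: le_trans xz.
by apply: le_lt_trans yT; rewrite lee_fin.
Qed.

Lemma forward_interval_segment T t : forward_interval T t ->
  `[0, t] `<=` forward_interval T.
Proof.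
move=> [t0 tT] s; rewrite /= in_itv/= => /andP[s0 st]; split=> //.
by apply: le_lt_trans tT; rewrite lee_fin.
Qed.

Lemma ivp_solutionP f x T u : ivp_solution f x T u <->
  u 0 = x /\ integral_curve f (forward_interval T) u.
Proof.
by split=> -[u0 fu]; split=> // t /fu /difference_quotientP.
Qed.

Lemma ivp_solution_unique f x T T' u v t : locally_lipschitz f ->
  ivp_solution f x T u -> ivp_solution f x T' v ->
  forward_interval T t -> forward_interval T' t -> u t = v t.
Proof.
move=> fl /ivp_solutionP[u0 fu] /ivp_solutionP[v0 fv] Tt T't.
have t0 := Tt.1.
apply: (integral_curve_unique f u v 0 t 0) => //; rewrite ?in_itv/= ?lexx ?t0//.
- exact: integral_curve_sub (forward_interval_segment _ _ Tt) fu.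
- exact: integral_curve_sub (forward_interval_segment _ _ T't) fv.
- by rewrite u0.
Qed.

Lemma maximal_solution_ge f x T T' u v : locally_lipschitz f ->
  maximal_solution f x T u -> ivp_solution f x T' v -> (T' <= T)%E.
Proof.
move=> fl [T0 fu umax] fv; rewrite leNgt; apply/negP => TT'.
suff E : T' = T by rewrite E ltxx in TT'.
apply: (umax T' v) => //; first exact: ltW.
move=> t Tt; apply/esym/(ivp_solution_unique f x T T' u v) => //.
by case: Tt => t0 tT; split=> //; exact: lt_trans TT'.
Qed.

(** The quadratic bound is closed in base value, end value and time step; this serves both at the
    end of an existence interval and for limits of translates. *)
Lemma quadratic_bound_cvg f C {X : Type} {F : set_system X} {FF : ProperFilter F}
    (a b : X -> E) (h : X -> R) (a' b' : E) (h' : R) : continuous f ->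
  a x @[x --> F] --> a' -> b x @[x --> F] --> b' -> h x @[x --> F] --> h' ->
  (\forall x \near F, `|b x - a x - h x *: f (a x)| <= C * h x ^+ 2) ->
  `|b' - a' - h' *: f a'| <= C * h' ^+ 2.
Proof.
move=> fc aa bb hh le; rewrite -subr_ge0.
pose D x := C * (h x * h x) - `|b x - a x - h x *: f (a x)|.
apply: (@cvgr_to_ge _ F _ R D); last first.
  by apply: filterS le => x; rewrite /D -expr2 subr_ge0.
have fa : f (a x) @[x --> F] --> f a' by apply: (cvg_comp a f aa); exact: fc.
rewrite expr2; apply: cvgB; first by apply: cvgMl_tmp; exact: cvgM.
by apply: cvg_norm; apply: cvgB; [exact: cvgB|exact: cvgZ].
Qed.

(** With a finite [T], the curve [u] is Lipschitz and so has a limit [p] at [T]; continuing with the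
    maximal solution from [p] contradicts maximality. *)
Lemma maximal_solution_bounded f (tmax : E -> \bar R) (phi : R -> E -> E) x r :
  locally_lipschitz f -> is_flow f tmax phi ->
  (forall t, forward_interval (tmax x) t -> `|phi t x| <= r) ->
  tmax x = +oo%E.
Proof.
move=> fl flow; have := flow x; set u := phi ^~ x.
case: (tmax x) => [T|//|]; last by case.
move=> umax ur; have [T0 fu _] := umax.
rewrite lte_fin in T0; have [u0 fu'] := (ivp_solutionP _ _ _ _).1 fu.
have IT t : forward_interval T%:E t <-> 0 <= t < T.
  by rewrite /forward_interval /= lte_fin; split=> [[-> ->]|/andP[]].
have nearT : \forall t \near T^'-, forward_interval T%:E t.
  apply: filterS2 (nbhs_left_gt T0) (nbhs_left_lt T) => t t0 tT.
  by apply/IT; rewrite tT ltW.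
have [L [B [L0 fL fB]]] := locally_lipschitz_ball f r fl.
have B0 : 0 <= B.
  by apply: le_trans (fB _ (ur 0 _)) => //; apply/IT; rewrite lexx.
pose K := [set y : E | `|y| <= r].
have itvT := forward_interval_is_interval T%:E.
have ulip := integral_curve_lipschitz f _ u B itvT fu' (fun t h => fB _ (ur t h)).
have uquad := integral_curve_quadratic f _ u K L B itvT fu' ur L0 fL fB.
have /cvg_ex[/= p up] : cvg (u t @[t --> T^'-]).
  apply/cauchy_cvgP/cauchy_exP => e e0.
  pose d := e / (B + 1); have B1 : 0 < B + 1 by rewrite ltr_wpDl.
  have d0 : 0 < d by exact: divr_gt0.
  pose s := Num.max 0 (T - d).
  have sT : s < T by rewrite gt_max T0 ltrBlDr ltrDl.
  have Is : forward_interval T%:E s by apply/IT; rewrite sT le_max lexx.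
  exists (u s); apply: filterS3 nearT (nbhs_left_gt sT) (nbhs_left_lt T).
  move=> t It st tT; rewrite /= -ball_normE /= distrC.
  apply: le_lt_trans (ulip _ _ Is It) _.
  rewrite ger0_norm ?subr_ge0 ?(ltW st)//.
  have td : t - s < d.
    have : T - d <= s by rewrite le_max lexx orbT.
    by lra.
  have : (B + 1) * (t - s) < e by rewrite mulrC -ltr_pdivlMr.
  apply: le_lt_trans; rewrite ler_wpM2r ?lerDl// subr_ge0 ltW//.
pose C := L * B.
(* Sending the base time to [T] gives the left derivative [f p] at the junction. *)
have uT s : forward_interval T%:E s ->
    `|u s - p - (s - T) *: f p| <= C * (s - T) ^+ 2.
  move=> Is; apply: (@quadratic_bound_cvg f C R T^'- _ u (cst (u s)) (fun t => s - t)).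
  - exact: (locally_lipschitz_continuous f fl).
  - exact: up.
  - exact: cvg_cst.
  - by apply: cvgB; [exact: cvg_cst|exact: cvg_at_left_filter].
  - by apply: filterS nearT => t It; exact: uquad.
have [tp0 fw _] := flow p; move: (tmax p) (phi ^~ p) tp0 fw => tp w tp0.
move=> /ivp_solutionP[w0 fw].
pose v t := if t < T then u t else w (t - T).
have Itp t : T <= t -> (t%:E < T%:E + tp)%E -> forward_interval tp (t - T).
  move=> Tt tT; split; first by rewrite subr_ge0.
  by rewrite EFinB lteBlDl.
suff /(maximal_solution_ge _ _ _ _ _ _ fl umax) : ivp_solution f x (T%:E + tp)%E v.
  by rewrite leNgt lteDl// tp0.
apply/ivp_solutionP; split; first by rewrite /v T0.
(* The glued curve follows [u] before [T] and [w] after; at [T] the left side uses [uT], the right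
   side [w]. *)
move=> t [t0 tT] e e0; rewrite {2 3}/v; have [tltT|Tt] := ltP t T.
  have [|d d0 hd] := fu' t _ e e0; first by apply/IT; rewrite t0.
  exists (Num.min d (T - t)); first by rewrite lt_min d0 subr_gt0.
  move=> s [s0 _]; rewrite lt_min => /andP[sd st].
  have sT : s < T by have := ler_norm (s - t); lra.
  by rewrite /v sT; apply: hd => //; apply/IT; rewrite s0.
have [d d0 hd] := fw _ (Itp _ Tt tT) e e0.
have right s : forward_interval (T%:E + tp) s -> T <= s -> `|s - t| < d ->
    `|w (s - T) - w (t - T) - (s - t) *: f (w (t - T))| <= e * `|s - t|.
  move=> [s0 sT] Ts sd; have st : s - T - (t - T) = s - t by ring.
  by have := hd (s - T) (Itp _ Ts sT); rewrite st; exact.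
have [tT'|tT'] := eqVneq t T; last first.
  have Tt' : T < t by rewrite lt_neqAle eq_sym tT'.
  exists (Num.min d (t - T)); first by rewrite lt_min d0 subr_gt0.
  move=> s Is; rewrite lt_min => /andP[sd st].
  have Ts : T <= s by have := ler_norm (t - s); rewrite distrC; lra.
  by rewrite /v ltNge Ts; exact: right.
subst t; have C1 : 0 < C + 1 by rewrite ltr_wpDl// mulr_ge0.
exists (Num.min d (e / (C + 1))); first by rewrite lt_min d0 divr_gt0.
move=> s Is; rewrite lt_min => /andP[sd se]; rewrite /v; case: ltP => sT.
  rewrite subrr w0; apply: le_trans (uT s _) _; first by apply/IT; rewrite Is.1.
  rewrite -real_normK ?num_real// expr2 mulrA ler_wpM2r//.
  rewrite ltr_pdivlMr// in se; apply: le_trans (ltW se).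
  by rewrite mulrC ler_wpM2l// lerDl.
exact: right.
Qed.

End MaximalSolutions.

(** * Complete solutions in the limit set and its invariance *)

Section OmegaLimit.
Context {R : realType} {n : nat}.
Local Notation E := 'rV[R]_n.
Context (f : E -> E) (tmax : E -> \bar R) (phi : R -> E -> E) (x0 : E).
Context (f_lip : locally_lipschitz f) (flow : is_flow f tmax phi).
Context (x0_bounded : bounded_set (positive_orbit tmax phi x0)).

Local Notation omega := (omega_limit tmax phi x0).
Local Notation u := (phi ^~ x0).

Lemma forward_interval_pinfty (t : R) : forward_interval +oo%E t <-> 0 <= t.
Proof. by split=> [[]//|t0]; split=> //; exact: ltry. Qed.

Lemma positive_orbit_bound :
  exists2 r : R, tmax x0 = +oo%E & forall t, 0 <= t -> `|u t| <= r.
Proof.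
have [M [Mreal h]] := x0_bounded.
have ur t : forward_interval (tmax x0) t -> `|u t| <= M + 1.
  by move=> It; apply: (h (M + 1)); rewrite ?ltrDl//; exists t.
have Tx0 := maximal_solution_bounded f tmax phi x0 (M + 1) f_lip flow ur.
exists (M + 1) => // t t0; apply: ur; rewrite Tx0.
exact/forward_interval_pinfty.
Qed.

Lemma omega_limitE y : omega y <-> exists t_ : nat -> R,
  [/\ forall k, 0 <= t_ k, t_ k @[k --> \oo] --> +oo & u (t_ k) @[k --> \oo] --> y].
Proof.
have [r Tx0 _] := positive_orbit_bound.
rewrite /omega_limit /= Tx0.
split=> -[t_ [h1 h2 h3]]; exists t_; split=> // k; exact/forward_interval_pinfty/h1.
Qed.

Lemma omega_limit_subsequence (s_ : nat -> R) :
  (forall k, 0 <= s_ k) -> s_ k @[k --> \oo] --> +oo ->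
  exists2 y, omega y & exists g : nat -> nat,
    u (s_ (g k)) @[k --> \oo] --> y.
Proof.
move=> s0 soo; have [r _ ur] := positive_orbit_bound.
have [|p [_ cp]] := compact_closed_ball0 r (u (s_ k) @[k --> \oo]) _.
  by exists 0%N => // k _ /=; exact/ur/s0.
have ex k : exists j, (k <= j)%N /\ `|p - u (s_ j)| < k.+1%:R^-1.
  have [||q [[j /= kj <-] pq]] := cp [set u (s_ j) | j in [set j | (k <= j)%N]]
      (ball p k.+1%:R^-1).
  - by exists k => // j kj /=; exists j.
  - by apply: nbhsx_ballx; rewrite invr_gt0.
  by exists j; split=> //; move: pq; rewrite -ball_normE.
have [g gP] := choice ex.
have goo : g k @[k --> \oo] --> \oo.
  apply/cvgnyPge => A; exists A => // k /= Ak.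
  exact: leq_trans Ak (gP k).1.
have gp : u (s_ (g k)) @[k --> \oo] --> p.
  apply/cvgrPdist_lt => e e0.
  apply: filterS (near_infty_natSinv_lt (PosNum e0)) => k /=.
  exact: lt_trans (gP k).2.
exists p; last by exists g.
apply/omega_limitE; exists (s_ \o g); split=> // [k|]; first exact: s0.
exact: cvg_comp goo soo.
Qed.

(** Gronwall propagates closeness at time 0 to any time [s], so the translates are Cauchy there;
    their common quadratic bound passes to the limit. *)
Lemma omega_limit_complete_curve y : omega y ->
  exists w : R -> E, [/\ w 0 = y, forall s, omega (w s) &
    integral_curve f setT w].
Proof.
move=> /omega_limitE[t_ [t0 too ty]].
have [r Tx0 ur] := positive_orbit_bound.
have [L [B [L0 fL fB]]] := locally_lipschitz_ball f r f_lip.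
pose K := [set z : E | `|z| <= r].
have uquad : quadratic_curve f (L * B) [set t | 0 <= t] u.
  have [_ /ivp_solutionP[_ fu] _] := flow x0; rewrite Tx0 in fu.
  have itv := forward_interval_is_interval (+oo%E : \bar R).
  have uK t : forward_interval +oo%E t -> K (u t).
    by move=> /forward_interval_pinfty; exact: ur.
  move=> s t s0 t0'.
  apply: (integral_curve_quadratic f _ u K L B itv fu uK L0 fL fB).
    exact/forward_interval_pinfty.
  exact/forward_interval_pinfty.
(* Clamping at 0 avoids negative times, where [phi] is unspecified; on bounded [s] it has no effect
   for large [k]. *)
pose pos k s := Num.max 0 (t_ k + s).
have posE (s : R) : \forall k \near \oo, forall x, `|x| <= s -> pos k x = t_ k + x.
  move/cvgryPge: too => /(_ s); apply: filterS => k sk x xs.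
  by apply/max_r; have := ler_norm (- x); rewrite normrN; lra.
have cvgw s : cvg (u (pos k s) @[k --> \oo]).
  apply/cauchy_cvgP/cauchy_exP => e e0.
  (* Two translates within [2 * d] at time 0 are within [e] at time [s]. *)
  pose d := e / 2 / expR (L * `|s|).
  have d0 : 0 < d by rewrite !divr_gt0// expR_gt0.
  have yd : \forall k \near \oo, `|y - u (t_ k)| < d.
    by move/cvgrPdist_lt : ty; apply.
  have near : \forall k \near \oo, (forall x, `|x| <= `|s| -> pos k x = t_ k + x) /\
      `|y - u (t_ k)| < d by exact: filterI (posE `|s|) yd.
  have [j [pj yj]] := filter_ex near.
  exists (u (pos j s)); apply: filterS near => k [pk yk].
  rewrite /= -ball_normE /=.
  pose I := [set x : R | `|x| <= `|s|].
  have itvI : is_interval I.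
    move=> a b; rewrite /I /= => + + c /andP[ac cb].
    by rewrite !ler_norml => /andP[h1 h2] /andP[h3 h4]; apply/andP; split; lra.
  have nonneg i x : pos i x = t_ i + x -> 0 <= t_ i + x.
    by move=> <-; rewrite le_max lexx.
  have quadI i : (forall x, `|x| <= `|s| -> pos i x = t_ i + x) ->
      quadratic_curve f (L * B) I (fun x => u (t_ i + x)).
    move=> pi a b Ia Ib; have := uquad _ _ (nonneg _ _ (pi a Ia)) (nonneg _ _ (pi b Ib)).
    by have -> : t_ i + b - (t_ i + a) = b - a by ring.
  have KI i : (forall x, `|x| <= `|s| -> pos i x = t_ i + x) ->
      forall x, I x -> K (u (t_ i + x)).
    by move=> pi x Ix; apply/ur/nonneg/pi.
  have I0 : I 0 by rewrite /I /= normr0.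
  have Is : I s by rewrite /I /=.
  rewrite pj// pk//.
  apply: le_lt_trans (quadratic_curve_gronwall f I _ _ K L _ itvI (quadI j pj)
    (quadI k pk) (KI j pj) (KI k pk) L0 fL 0 s I0 Is) _.
  rewrite subr0 !addr0 mulrC -ltr_pdivlMr ?expR_gt0//.
  rewrite -(subrKA y); apply: le_lt_trans (ler_normD _ _) _.
  rewrite distrC.
  have -> : e / expR (L * `|s|) = d + d by rewrite /d; field; rewrite lt0r_neq0 ?expR_gt0.
  exact: ltrD.
pose w s := lim (u (pos k s) @[k --> \oo]).
have wP s : u (pos k s) @[k --> \oo] --> w s by exact: cvgw.
have pos_pinfty s : pos k s @[k --> \oo] --> +oo.
  apply/cvgryPge => A; move/cvgryPge: too => /(_ (A - s)).
  by apply: filterS => k h; rewrite le_max; apply/orP; right; lra.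
exists w; split.
- have <- : lim (u (t_ k) @[k --> \oo]) = y by exact: cvg_lim.
  by congr (lim _); apply/funext => A; rewrite /fmap /=; congr (nbhs _ _);
     apply/funext => k /=; rewrite /pos addr0 max_r.
- move=> s; apply/omega_limitE; exists (pos ^~ s); split=> // k.
  by rewrite le_max lexx.
- apply: (@quadratic_curve_integral _ _ f (L * B)) => s t _ _.
  apply: (@quadratic_bound_cvg _ _ f (L * B) _ \oo _ (fun k => u (pos k s))
    (fun k => u (pos k t)) (cst (t - s))) => //.
  + exact: locally_lipschitz_continuous f_lip.
  + exact: cvg_cst.
  + apply: filterS (posE (`|s| + `|t|)) => k pk.
    have ps := pk s _; have pt := pk t _.
    have := uquad (pos k s) (pos k t); rewrite /= !le_max lexx => /(_ isT isT).
    rewrite ps ?lerDl// pt ?lerDr//.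
    by have -> : t_ k + t - (t_ k + s) = t - s by ring.
Qed.

(** Uniqueness matches the flow with complete curves in the limit set: forwards from [y], and
    backwards from [phi t y], whose curve passes through [y] at time [- t]. *)
Lemma omega_limit_invariant : invariant_set tmax phi omega.
Proof.
have ne : omega !=set0.
  have [||y oy _] := omega_limit_subsequence (fun k => k%:R).
  - by move=> k.
  - exact: cvgr_idn.
  by exists y.
split; split=> //.
  move=> y oy t It; have [w [w0 ow fw]] := omega_limit_complete_curve y oy.
  have wsol : ivp_solution f y +oo%E w.
    by apply/ivp_solutionP; split=> //; exact: integral_curve_sub fw.
  have [_ ysol _] := flow y.
  rewrite (ivp_solution_unique f y _ _ _ w t f_lip ysol wsol)//.
  exact/forward_interval_pinfty/It.1.
move=> y t It oz; have [w [w0 ow fw]] := omega_limit_complete_curve _ oz.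
have [_ /ivp_solutionP[y0 fy] _] := flow y.
have t0 := It.1.
suff -> : y = w (0 - t) by exact: ow.
rewrite -[LHS]y0.
apply: (integral_curve_unique f (phi ^~ y) (fun s => w (s - t)) 0 t t f_lip).
- exact: integral_curve_sub (forward_interval_segment _ _ It) fy.
- move=> s _ e e0; have [d d0 hd] := fw (s - t) I e e0.
  exists d => // s' _ ss'; have E : s' - t - (s - t) = s' - s by ring.
  by have := hd (s' - t) I; rewrite E; exact.
- by rewrite in_itv/= t0 lexx.
- by rewrite subrr w0.
- by rewrite in_itv/= t0 lexx.
Qed.

End OmegaLimit.

(** * Derivative of a function along a curve *)

Section LieDerivative.
Context {R : realType} {n : nat}.
Local Notation E := 'rV[R]_n.
Implicit Types (f : E -> E) (V : E -> R) (u : R -> E).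

(** The function whose zero set is [orbital_critical_set f V], named so that its sign and continuity
    can be used. *)
Definition lie_derivative V f (x : E) : R :=
  \sum_i gradient V x 0 i * f x 0 i.

Lemma has_derivative_at_is_derive (D : set R) u (t : R) (v : E) :
  nbhs t D -> has_derivative_at D u t v -> is_derive t 1 u v.
Proof.
move=> tD du.
suff cv : h^-1 *: ((u \o shift t) (h *: 1) - u t) @[h --> 0^'] --> v.
  by split; [apply/cvg_ex; exists v|exact: cvg_lim cv].
apply/cvgrPdist_le => e e0; have [d d0 hd] := du _ e0.
have [d' /= d'0 Dd'] := (nbhs_ballP t D).1 tD.
rewrite /dnbhs near_withinE; apply/nbhs_ballP.
exists (Num.min d d'); first by rewrite /= lt_min d0 d'0.
move=> h; rewrite -ball_normE /= sub0r normrN lt_min => /andP[hd1 hd2] h0.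
have ht : h + t - t = h by rewrite addrK.
have := hd (h + t); rewrite ht => /(_ _ hd1).
rewrite -[h *: 1]/(h * 1) mulr1.
have -> : v - h^-1 *: (u (h + t) - u t) = - (h^-1 *: (u (h + t) - u t - h *: v)).
  by rewrite [in RHS]scalerBr scalerA mulVf// scale1r opprB.
move=> /(_ _) H; rewrite normrN normrZ normfV mulrC ler_pdivrMr ?normr_gt0//.
apply: H; apply: Dd'; rewrite -ball_normE /= distrC ht; exact: hd2.
Qed.

Lemma is_derive_lie V f (D : set R) u (t : R) : (forall x, differentiable V x) ->
  nbhs t D -> has_derivative_at D u t (f (u t)) ->
  is_derive t 1 (V \o u) (lie_derivative V f (u t)).
Proof.
move=> dV tD /(has_derivative_at_is_derive _ _ _ _ tD) du.
have du1 : differentiable u t by apply/derivable1_diffP; exact: ex_derive.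
have dVu : differentiable (V \o u) t by exact: differentiable_comp.
split; first by apply/derivable1_diffP.
rewrite deriveE// diff_comp//= -[X in 'd V _ X]deriveE// derive_val.
(* Expanding the velocity in the canonical basis turns the differential into the entries of
   [gradient]. *)
rewrite [in LHS](row_sum_delta (f (u t))) linear_sum; apply: eq_bigr => i _.
by rewrite linearZ /= /gradient mxE mulrC deriveE.
Qed.

Lemma lie_derivative_continuous V f : C1 V -> continuous f ->
  continuous (lie_derivative V f).
Proof.
move=> [_ cV] cf x.
apply: (@cvg_big _ _ _ _ _ add_continuous _ (nbhs (x : E)) _
  (fun i y => gradient V y 0 i * f y 0 i)) => i _.
apply: cvgM.
  by apply: (cvg_comp (gradient V) (fun v : E => v 0 i) (cV x)); exact: coord_continuous.
by apply: (cvg_comp f (fun v : E => v 0 i) (cf x)); exact: coord_continuous.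
Qed.

End LieDerivative.

(** * Behaviour of [V] along the orbit and on its limit set *)

Section LimitSetLevel.
Context {R : realType} {n : nat}.
Local Notation E := 'rV[R]_n.
Context (f : E -> E) (tmax : E -> \bar R) (phi : R -> E -> E) (x0 : E).
Context (f_lip : locally_lipschitz f) (flow : is_flow f tmax phi).
Context (x0_bounded : bounded_set (positive_orbit tmax phi x0)).
Context (V : E -> R) (V_C1 : C1 V).

Local Notation omega := (omega_limit tmax phi x0).
Local Notation u := (phi ^~ x0).
Local Notation g := (lie_derivative V f).
Local Notation S := (orbital_critical_set f V).

Lemma orbit_integral_curve : integral_curve f [set t | 0 <= t] u.
Proof.
have [r Tx0 _] := positive_orbit_bound f tmax phi x0 f_lip flow x0_bounded.
have [_ /ivp_solutionP[_ fu] _] := flow x0; rewrite Tx0 in fu.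
by apply: integral_curve_sub fu => t /forward_interval_pinfty.
Qed.

(** The translated orbit is a solution on the whole half-line, so [tmax] is infinite at [u t] and
    uniqueness applies. This places orbit points in [A] when [S] is met later. *)
Lemma orbit_shift (t s : R) : 0 <= t -> 0 <= s ->
  forward_interval (tmax (u t)) s /\ phi s (u t) = u (t + s).
Proof.
move=> t0 s0.
have sol : ivp_solution f (u t) +oo%E (fun s => u (t + s)).
  apply/ivp_solutionP; split; first by rewrite addr0.
  move=> a /forward_interval_pinfty a0 e e0.
  have [|d d0 hd] := orbit_integral_curve (t + a) _ e e0; first exact: addr_ge0.
  exists d => // b /forward_interval_pinfty b0 ba.
  have E : t + b - (t + a) = b - a by ring.
  by have := hd (t + b) (addr_ge0 t0 b0); rewrite E; exact.
have Tt : tmax (u t) = +oo%E.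
  apply/eqP; rewrite -leye_eq.
  exact: (maximal_solution_ge _ _ _ _ _ _ f_lip (flow _) sol).
have Is : forward_interval +oo%E s by exact/forward_interval_pinfty.
rewrite Tt; split=> //.
have [_ sol' _] := flow (u t); rewrite Tt in sol'.
exact: (ivp_solution_unique f (u t) _ _ _ _ s f_lip sol' sol Is Is).
Qed.

Lemma is_derive_orbit (t : R) : 0 < t -> is_derive t 1 (V \o u) (g (u t)).
Proof.
move=> t0; apply: (is_derive_lie V f [set t | 0 <= t]).
- exact: V_C1.1.
- by apply: filterS (lt_nbhsr t0) => s /ltW.
- exact/orbit_integral_curve/ltW.
Qed.

Lemma lie_continuous_orbit (t : R) : 0 < t -> {for t, continuous (g \o u)}.
Proof.
move=> t0; apply: continuous_comp; last first.
  by apply: lie_derivative_continuous => //; exact: locally_lipschitz_continuous.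
apply/differentiable_continuous/derivable1_diffP.
have du : is_derive t 1 u (f (u t)).
  apply: (has_derivative_at_is_derive [set t | 0 <= t]).
    by apply: filterS (lt_nbhsr t0) => s /ltW.
  exact/orbit_integral_curve/ltW.
exact: ex_derive.
Qed.

(* If the orbit eventually avoids [S], the orbital derivative keeps a constant *)
(* sign, so [V] is eventually monotone along the orbit and has a single limit. *)
Lemma omega_limit_level N : (forall t, N <= t -> 0 <= t -> ~ S (u t)) ->
  forall y z, omega y -> omega z -> V y = V z.
Proof.
(* [N1 >= 1] keeps times positive, where derivatives along the orbit are two-sided. *)
move=> noS; pose N1 := Num.max N 1.
have N1pos t : N1 <= t -> 0 < t.
  by apply: lt_le_trans; rewrite lt_max ltr01 orbT.
have nz t : N1 <= t -> g (u t) != 0.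
  move=> Nt; apply/eqP; apply: noS; last exact/ltW/N1pos.
  by apply: le_trans Nt; rewrite le_max lexx.
(* A sign change would give a zero after [N1] by the intermediate value theorem. *)
have sgn t : N1 <= t -> 0 < g (u N1) * g (u t).
  move=> Nt; rewrite ltNge; apply/negP => le0.
  have [|||c + gc0] := @IVT _ (g \o u) N1 t 0.
  - exact: Nt.
  - apply: continuous_in_subspaceT => s; rewrite inE /= in_itv/= => /andP[Ns _].
    exact/lie_continuous_orbit/N1pos.
  - rewrite ge_min le_max /=.
    by case: (ltP 0 (g (u N1))) le0 => h1; case: (ltP 0 (g (u t))) => h2 le0 //=;
       rewrite ?orbT ?(ltW h1) ?(ltW h2)//=; nra.
  by rewrite in_itv/= => /andP[/nz/eqP + _]; apply.
(* The constant factor [g (u N1)] treats increasing and decreasing [V] at once. *)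
have mono a b : N1 <= a -> a <= b ->
    g (u N1) * V (u a) <= g (u N1) * V (u b).
  move=> Na ab; rewrite -subr_ge0 -mulrBr.
  have [|||c + ->] := @MVT_segment _ (V \o u) (g \o u) a b.
  - exact: ab.
  - move=> s; rewrite in_itv/= => /andP[as_ _]; apply: is_derive_orbit.
    exact/N1pos/ltW/(le_lt_trans Na).
  - apply: derivable_within_continuous => s; rewrite in_itv/= => /andP[as_ _].
    have ds := is_derive_orbit s (N1pos s (le_trans Na as_)).
    exact: ex_derive.
  rewrite in_itv/= => /andP[ac _]; rewrite mulrA mulr_ge0 ?subr_ge0//.
  exact/ltW/sgn/(le_trans Na).
have Vc := fun x => differentiable_continuous (V_C1.1 x).
(* For fixed [k], the times [t_ j] eventually exceed [s_ k]; let [j], then [k], tend to infinity. *)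
have le y z : omega y -> omega z -> g (u N1) * V y <= g (u N1) * V z.
  move=> /(omega_limitE f tmax phi x0 f_lip flow x0_bounded)[s_ [_ soo sy]].
  move=> /(omega_limitE f tmax phi x0 f_lip flow x0_bounded)[t_ [_ too tz]].
  have cy : g (u N1) * V (u (s_ k)) @[k --> \oo] --> g (u N1) * V y.
    by apply: cvgMl_tmp; apply: (cvg_comp _ V sy); exact: Vc.
  have cz : g (u N1) * V (u (t_ k)) @[k --> \oo] --> g (u N1) * V z.
    by apply: cvgMl_tmp; apply: (cvg_comp _ V tz); exact: Vc.
  apply: (cvgr_to_le cy); move/cvgryPge: soo => /(_ N1).
  apply: filterS => k Nk; apply: (cvgr_to_ge cz).
  by move/cvgryPge: too => /(_ (s_ k)); apply: filterS => j; exact: mono.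
move=> y z oy oz; apply: (mulfI (nz N1 (lexx _))).
by apply/le_anti; rewrite !le.
Qed.

(** [V] is constant along a complete curve through [y], so its derivative at the interior time 0,
    equal to [g y], vanishes. *)
Lemma omega_limit_critical :
  (forall y z, omega y -> omega z -> V y = V z) -> omega `<=` S.
Proof.
move=> Vconst y oy.
have [w [w0 ow fw]] :=
  omega_limit_complete_curve f tmax phi x0 f_lip flow x0_bounded y oy.
have : is_derive (0 : R) 1 (V \o w) (g (w 0)).
  apply: (is_derive_lie V f setT); [exact: V_C1.1|exact: filterT|exact: fw].
have -> : V \o w = cst (V y) by apply/funext => t /=; exact: Vconst.
by rewrite w0 => -[_]; rewrite derive_cst => /esym.
Qed.

End LimitSetLevel.

(** * Position of the limit set relative to [S] and [M] *)

Theorem theorem2 (R : realType) (n : nat)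
    (f : 'rV[R]_n -> 'rV[R]_n) (f_lip : locally_lipschitz f)
    (tmax : 'rV[R]_n -> \bar R) (phi : R -> 'rV[R]_n -> 'rV[R]_n)
    (phi_flow : is_flow f tmax phi)
    (x0 : 'rV[R]_n) (x0_bounded : bounded_set (positive_orbit tmax phi x0))
    (V : 'rV[R]_n -> R) (V_C1 : C1 V) :
  let S := orbital_critical_set f V in
  let A := reaches tmax phi S in
  let M := largest_invariant_set tmax phi (closure A) in
  omega_limit tmax phi x0 `&` S !=set0 /\ omega_limit tmax phi x0 `<=` M.
Proof.
move=> S A M.
have gc : continuous (lie_derivative V f).
  by apply: lie_derivative_continuous => //; exact: locally_lipschitz_continuous.
have inv := omega_limit_invariant f tmax phi x0 f_lip phi_flow x0_bounded.
(* By invariance, the limit set is itself a member of the union defining [M] once it lies in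
   [closure A]. *)
have subM : omega_limit tmax phi x0 `<=` closure A ->
    omega_limit tmax phi x0 `<=` M.
  by move=> sub y oy; exists (omega_limit tmax phi x0).
have [Sinf|] := pselect (forall N : R, exists t, [/\ N <= t, 0 <= t & S (phi t x0)]).
  split.
    have [s_ sP] := choice (fun k : nat => Sinf k%:R).
    have [||p op [h hp]] :=
        omega_limit_subsequence f tmax phi x0 f_lip phi_flow x0_bounded s_.
    - by move=> k; case: (sP k).
    - apply/cvgryPge => B; move/cvgryPge : (@cvgr_idn R) => /(_ B).
      by apply: filterS => k Bk; apply: le_trans Bk _; case: (sP k).
    exists p; split=> //.
    have cp : lie_derivative V f (phi (s_ (h k)) x0) @[k --> \oo] -->
        lie_derivative V f p.
      by apply: (cvg_comp _ (lie_derivative V f) hp); exact: gc.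
    have c0 : lie_derivative V f (phi (s_ (h k)) x0) @[k --> \oo] --> (0 : R).
      rewrite (_ : (fun k => _) = cst 0); first exact: cvg_cst.
      by apply/funext => k; case: (sP (h k)).
    exact: (cvg_unique _ cp c0).
  apply: subM => y /(omega_limitE f tmax phi x0 f_lip phi_flow x0_bounded).
  move=> [t_ [t0 _ ty]]; apply: (closed_cvg _ (@closed_closure _ A) _ _ ty).
  apply: nearW => k; apply: subset_closure.
  (* A visit to [S] at [t], no earlier than [t_ k], puts the point at time [t_ k] in [A]. *)
  have [t [tk t0' St]] := Sinf (t_ k).
  have [It E] := orbit_shift f tmax phi x0 f_lip phi_flow x0_bounded (t_ k) (t - t_ k)
    (t0 k) (etrans (subr_ge0 _ _) tk).
  by exists (t - t_ k) => //; rewrite E subrKC.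
move=> /existsNP[N SN].
have oS : omega_limit tmax phi x0 `<=` S.
  apply: (omega_limit_critical f tmax phi x0 f_lip phi_flow x0_bounded V V_C1).
  apply: (omega_limit_level f tmax phi x0 f_lip phi_flow x0_bounded V V_C1 N).
  by move=> t Nt t0 St; apply: SN; exists t.
split; first by have [y oy] := inv.1.1; exists y; split=> //; exact: oS.
(* Points of [S] belong to [A] with time 0, which is admissible because [tmax y] is positive. *)
apply: subM => y oy; apply: subset_closure.
have [T0 [phi0 _] _] := phi_flow y.
by exists 0; [split|rewrite phi0; exact: oS].
Qed.
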